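(* Let $(x^k)_{k\in\mathbb{N}}$ be an infinite sequence generated by GInexPM with constant step size $\alpha$ satisfying $0<\alpha<(1-2\bar\gamma)/L$ (as described in the context). Assume that $f$ is convex and let $x^*\in\Omega^*\neq\varnothing$, $f^*=f(x^* )$, $\rho:=\alpha/(1-2\bar\gamma_2)$. Then, for every integer $N\ge 1$, $$\min\{f(x^k)-f^*:\ k=1,\dots,N\}\le\frac{\|x^0-x^*\|^2+2\alpha\rho\,b_{-1}}{2\alpha N}.$$
   Context: Setting. $C\subset\mathbb{R}^n$ is a nonempty closed convex set, $f:\mathbb{R}^n\to\mathbb{R}$ is continuously differentiable, $\Omega^*$ is the set of minimizers of $f$ over $C$, $\langle\cdot,\cdot\rangle$ and $\|\cdot\|$ are the Euclidean inner product and norm, and $\mathbb{N}=\{0,1,2,\dots\}$. Convexity of $f$ means $f(y)-f(x)-\langle\nabla f(x),y-x\rangle\ge 0$ for all $x,y\in C$. The gradient is Lipschitz on $C$ with constant $L>0$: $\|\nabla f(x)-\nabla f(y)\|\le L\|x-y\|$ for all $x,y\in C$. Inexact projection. For each $\gamma=(\gamma_1,\gamma_2,\gamma_3)\in\mathbb{R}^3_+$ (nonnegative entries), $\varphi_\gamma:\mathbb{R}^n\times\mathbb{R}^n\times\mathbb{R}^n\to[0,\infty)$ is a function with $\varphi_\gamma(u,v,w)\le\gamma_1\|v-u\|^2+\gamma_2\|w-v\|^2+\gamma_3\|w-u\|^2$ for all $u,v,w$. For $u\in C$ and $v\in\mathbb{R}^n$, $\mathcal{P}_C(\varphi_\gamma,u,v):=\{w\in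 C:\langle v-w,y-w\rangle\le\varphi_\gamma(u,v,w)\ \forall y\in C\}$. GInexPM with constant step size. Fix a nonincreasing sequence $(b_k)_{k\in\mathbb{N}}$ of nonnegative reals converging to $0$, a real $b_{-1}>b_0$ with $b_{-1}>0$, and reals $a_k$ with $0\le a_k\le b_{k-1}-b_k$ for all $k\in\mathbb{N}$. Fix constants $\bar\gamma_2<1/2$, $\bar\gamma<1/2$ and a step size $\alpha$ with $0<\alpha<(1-2\bar\gamma)/L$. Start from $x^0\in C$. At iteration $k$: if $\nabla f(x^k)=0$ stop; otherwise choose reals $\gamma_1^k,\gamma_2^k,\gamma_3^k\ge 0$ with $\gamma_1^k+\gamma_2^k\le a_k/\|\nabla f(x^k)\|^2$, $\gamma_2^k<\bar\gamma_2$, $\gamma_3^k<\bar\gamma$, set $\gamma^k=(\gamma_1^k,\gamma_2^k,\gamma_3^k)$, $z^k:=x^k-\alpha\nabla f(x^k)$, and let $x^{k+1}$ be any element of $\mathcal{P}_C(\varphi_{\gamma^k},x^k,z^k)$. ''Infinite sequence generated'' means the algorithm never stops. *)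

(* Defs.v *)
From HB Require Import structures.
From mathcomp Require Import all_boot all_order all_algebra.
From mathcomp Require Import all_classical all_reals all_analysis.

Set Implicit Arguments.
Unset Strict Implicit.
Unset Printing Implicit Defensive.

Import Order.TTheory GRing.Theory Num.Theory.
Import numFieldNormedType.Exports.

Local Open Scope classical_set_scope.
Local Open Scope ring_scope.

Definition dotv (R : realType) (n : nat) (u v : 'rV[R]_n) : R :=
  \sum_(i < n) u ord0 i * v ord0 i.

(* The library norm on 'rV[R]_n is the sup norm.  It induces the Euclidean
   topology, so [closed], [continuous] and [differentiable] are the usual
   notions, but the Euclidean norm has to be introduced separately. *)
Definition enorm (R : realType) (n : nat) (u : 'rV[R]_n) : R :=
  Num.sqrt (dotv u u).

Definition gradient (R : realType) (n : nat) (f : 'rV[R]_n -> R)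
    (x : 'rV[R]_n) : 'rV[R]_n :=
  \row_(i < n) 'D_(delta_mx ord0 i) f x.

(* ['D_v f x] is a total operator: differentiability is required explicitly. *)
Definition continuously_differentiable (R : realType) (n : nat)
    (f : 'rV[R]_n -> R) : Prop :=
  (forall x, differentiable f x) /\ continuous (gradient f).

Definition gradient_convex_on (R : realType) (n : nat) (C : set 'rV[R]_n)
    (f : 'rV[R]_n -> R) : Prop :=
  forall x y, C x -> C y -> 0 <= f y - f x - dotv (gradient f x) (y - x).

Definition gradient_lipschitz_on (R : realType) (n : nat) (C : set 'rV[R]_n)
    (L : R) (f : 'rV[R]_n -> R) : Prop :=
  forall x y, C x -> C y ->
    enorm (gradient f x - gradient f y) <= L * enorm (x - y).

Definition minimizers (R : realType) (n : nat) (C : set 'rV[R]_n)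
    (f : 'rV[R]_n -> R) : set 'rV[R]_n :=
  [set x | C x /\ forall y, C y -> f x <= f y].

(* [phi g1 g2 g3 u v w] is the error tolerance with parameter
   (g1, g2, g3); it is constrained only on the nonnegative orthant. *)
Definition error_tolerance (R : realType) (n : nat)
    (phi : R -> R -> R -> 'rV[R]_n -> 'rV[R]_n -> 'rV[R]_n -> R) : Prop :=
  forall g1 g2 g3 : R, 0 <= g1 -> 0 <= g2 -> 0 <= g3 ->
  forall u v w : 'rV[R]_n,
    0 <= phi g1 g2 g3 u v w /\
    phi g1 g2 g3 u v w <= g1 * enorm (v - u) ^+ 2 + g2 * enorm (w - v) ^+ 2
                          + g3 * enorm (w - u) ^+ 2.

Definition inexact_proj (R : realType) (n : nat) (C : set 'rV[R]_n)
    (phi : 'rV[R]_n -> 'rV[R]_n -> 'rV[R]_n -> R) (u v : 'rV[R]_n) :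
    set 'rV[R]_n :=
  [set w | C w /\ forall y, C y -> dotv (v - w) (y - w) <= phi u v w].

(* [prev_seq bm1 b k] is b_{k-1}, with b_{-1} = bm1. *)
Definition prev_seq (R : realType) (bm1 : R) (b : nat -> R) (k : nat) : R :=
  if k is k'.+1 then b k' else bm1.

Definition forcing_sequences (R : realType) (bm1 : R) (a b : nat -> R) : Prop :=
  [/\ nonincreasing_seq b,
      forall k, 0 <= b k,
      b @ \oo --> (0 : R),
      b 0%N < bm1 /\ 0 < bm1
    & forall k, 0 <= a k /\ a k <= prev_seq bm1 b k - b k].

(* Infinite runs only: the stopping test never succeeds. *)
Definition GInexPM_infinite (R : realType) (n : nat) (C : set 'rV[R]_n)
    (f : 'rV[R]_n -> R)
    (phi : R -> R -> R -> 'rV[R]_n -> 'rV[R]_n -> 'rV[R]_n -> R)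
    (a : nat -> R) (gbar2 gbar alpha : R) (x : nat -> 'rV[R]_n) : Prop :=
  C (x 0%N) /\
  forall k : nat,
    gradient f (x k) != 0 /\
    exists g1 g2 g3 : R,
      [/\ [/\ 0 <= g1, 0 <= g2 & 0 <= g3],
          g1 + g2 <= a k / enorm (gradient f (x k)) ^+ 2,
          g2 < gbar2,
          g3 < gbar
        & inexact_proj C (phi g1 g2 g3) (x k)
            (x k - alpha *: gradient f (x k)) (x k.+1)].

(* Main.v *)
Require Import Defs.
From HB Require Import structures.
From mathcomp Require Import all_boot all_order all_algebra.
From mathcomp Require Import all_classical all_reals all_analysis.
From mathcomp Require Import ring lra.

Set Implicit Arguments.
Unset Strict Implicit.
Unset Printing Implicit Defensive.

Import Order.TTheory GRing.Theory Num.Theory.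
Import numFieldNormedType.Exports.

Local Open Scope classical_set_scope.
Local Open Scope ring_scope.

(** Fix a minimizer [p], write [x], [w] for two consecutive iterates and [z] for
    the gradient step [x - alpha * gradient f x] that is projected.  The
    quantity that decreases is the squared distance to [p] plus what is left of
    the error budget, [V k = |x k - p|^2 + 2 * alpha * rho * b_(k-1)], and in
    one iteration it decreases by at least [2 * alpha * (f w - f p)].  Since
    [V] is nonnegative, the values [f (x k) - f p] for [k = 1 .. N] sum to at
    most [V 0 / (2 * alpha)]; their minimum is at most their mean
    ([bigmin_le_mean]).

    The one-step decrease ([inexact_step]) combines four facts.  Testing the
    inexact projection at [y = p] is the usual three-point inequality up to an
    error; convexity bounds [f p] from below by the linear model of [f] at [x];
    the descent lemma ([descent]) bounds [f w] from above by the same model plus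
    [L / 2 * |w - x|^2].  What remains is the error: [gamma1] and the main part
    of [gamma2] cost [alpha^2 * a k], and [gamma3] is absorbed by the slack in
    [alpha * L < 1 - 2 * gbar], but expanding [|w - z|^2] leaves a cross term
    [gamma2 * <gradient, w - x>] that has no sign.  Testing the projection at
    [y = x] as well bounds this inner product from above; this is where the
    factor [1 / (1 - 2 * gamma2)], hence [rho], comes from: the error of one
    iteration is at most [2 * alpha * rho * a k], and [a k] is at most the drop
    from [b_(k-1)] to [b_k]. *)

(** * The Euclidean inner product *)

Section InnerProduct.
Context {R : realType} {n : nat}.
Implicit Types u v w : 'rV[R]_n.

Lemma dotvC u v : dotv u v = dotv v u.
Proof. by apply: eq_bigr => i _; rewrite mulrC. Qed.

Lemma dotvDl u v w : dotv (u + v) w = dotv u w + dotv v w.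
Proof. by rewrite -big_split; apply: eq_bigr => i _; rewrite mxE mulrDl. Qed.

Lemma dotvZl (c : R) u v : dotv (c *: u) v = c * dotv u v.
Proof. by rewrite mulr_sumr; apply: eq_bigr => i _; rewrite mxE mulrA. Qed.

Lemma dotvNl u v : dotv (- u) v = - dotv u v.
Proof. by rewrite -scaleN1r dotvZl mulN1r. Qed.

Lemma dotvDr u v w : dotv u (v + w) = dotv u v + dotv u w.
Proof. by rewrite dotvC dotvDl !(dotvC u). Qed.

Lemma dotvZr (c : R) u v : dotv u (c *: v) = c * dotv u v.
Proof. by rewrite dotvC dotvZl (dotvC u). Qed.

Lemma dotvNr u v : dotv u (- v) = - dotv u v.
Proof. by rewrite dotvC dotvNl (dotvC u). Qed.

Definition dotvE := (dotvDl, dotvDr, dotvNl, dotvNr, dotvZl, dotvZr).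

Lemma dotv_ge0 u : 0 <= dotv u u.
Proof. by apply: sumr_ge0 => i _; rewrite -expr2 sqr_ge0. Qed.

Lemma dotv_eq0 u : (dotv u u == 0) = (u == 0).
Proof.
apply/idP/eqP => [|->]; last by rewrite -(scale0r 0) dotvZl mul0r.
rewrite psumr_eq0 => [/allP u0|i _]; last by rewrite -expr2 sqr_ge0.
apply/rowP => i; have := u0 i (mem_index_enum i).
by rewrite -expr2 sqrf_eq0 mxE => /eqP.
Qed.

Lemma enorm_ge0 u : 0 <= enorm u.
Proof. exact: sqrtr_ge0. Qed.

Lemma sqr_enorm u : enorm u ^+ 2 = dotv u u.
Proof. by rewrite sqr_sqrtr ?dotv_ge0. Qed.

(** The case of the Cauchy-Schwarz inequality needed below; it only takes
    expanding [0 <= |u - c *: v|^2]. *)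
Lemma dotv_le_enorm (c : R) u v :
  0 < c -> enorm u <= c * enorm v -> dotv u v <= c * dotv v v.
Proof.
move=> c0 uv.
have uu : dotv u u <= c ^+ 2 * dotv v v.
  rewrite -!sqr_enorm -exprMn lerXn2r// nnegrE ?enorm_ge0//.
  by rewrite mulr_ge0 ?enorm_ge0// ltW.
have := dotv_ge0 (u - c *: v); rewrite !dotvE (dotvC v u) => h.
by rewrite -(ler_pM2l c0); nra.
Qed.

End InnerProduct.

(** * The descent lemma *)

Section Descent.
Context {R : realType} {n : nat}.
Variables (C : set 'rV[R]_n) (f : 'rV[R]_n -> R).

Lemma derive_gradient (x v : 'rV[R]_n) :
  differentiable f x -> 'D_v f x = dotv (gradient f x) v.
Proof.
move=> df; rewrite deriveE// [v in LHS]row_sum_delta linear_sum.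
by apply: eq_bigr => i _; rewrite linearZ mxE deriveE// mulrC.
Qed.

Lemma convex_set_segment (x y : 'rV[R]_n) (t : R) :
  convex_set C -> C x -> C y -> 0 <= t -> t <= 1 -> C (x + t *: (y - x)).
Proof.
move=> cC Cx Cy t0 t1; have t01 : 0 <= t <= 1 by rewrite t0.
have := cC y x (Itv01 t0 t1) (mem_set Cy) (mem_set Cx).
move/set_mem; congr C; rewrite /conv/= /unstable.onem scalerBl scale1r scalerBr.
by rewrite addrCA.
Qed.

Lemma is_derive_segment (x d : 'rV[R]_n) (t : R) :
  differentiable f (x + t *: d) ->
  is_derive t 1 (fun s => f (x + s *: d)) (dotv (gradient f (x + t *: d)) d).
Proof.
move=> df.
pose g s := x + s *: d.
have dg : is_diff t g (fun s => s *: d).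
  have := is_diffD (is_diff_cst x t) (is_diff_scalel t d).
  by rewrite add0r.
have dfg : differentiable (f \o g) t by exact: differentiable_comp.
apply: DeriveDef; first exact/derivable1_diffP.
have dg_t : differentiable g t by exact: ex_diff.
change ('D_1 (f \o g) t = dotv (gradient f (g t)) d).
by rewrite deriveE// (diff_comp dg_t df)/= diff_val scale1r -deriveE//
  derive_gradient.
Qed.

(** The first-order remainder along the segment,
    [h t = f (x + t d) - t <gradient f x, d> - L / 2 * t^2 * |d|^2], has
    nonpositive derivative on [0, 1], because the gradient moves by at most
    [L * t * |d|]. *)
Lemma descent (L : R) (x y : 'rV[R]_n) :
  convex_set C -> (forall z, differentiable f z) -> 0 < L ->
  gradient_lipschitz_on C L f -> C x -> C y ->
  f y <= f x + dotv (gradient f x) (y - x) + L / 2 * dotv (y - x) (y - x).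
Proof.
move=> cC df L0 lipf Cx Cy; set d := y - x; set m := dotv (gradient f x) d.
pose h (t : R) := f (x + t *: d) - m * t - L / 2 * dotv d d * t ^+ 2.
pose h' (t : R) := dotv (gradient f (x + t *: d)) d - m - L * dotv d d * t.
have dh (t : R) : is_derive t 1 h (h' t).
  have df_t : is_derive t 1 _ _ := is_derive_segment (df (x + t *: d)).
  have := is_deriveB (is_deriveB df_t (is_deriveZ m (is_derive_id t 1)))
    (is_deriveZ (L / 2 * dotv d d) (is_deriveX 2 (is_derive_id t 1))).
  move=> H; apply: (is_derive_eq H).
  by rewrite /h' /= /GRing.scale/= expr1; field.
have ch : {within `[0, 1], continuous h}.
  apply: continuous_subspaceT => t.
  by apply/differentiable_continuous/derivable1_diffP/ex_derive.
have [t t01] := MVT ltr01 (fun t _ => dh t) ch.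
rewrite subr0 mulr1 /h scale1r scale0r addr0 /d subrKC -/d => eh.
suff : h' t <= 0 by move: eh; rewrite expr1n expr0n/=; lra.
have {t01} [t0 t1] : 0 < t /\ t < 1 by move: t01; rewrite in_itv/= => /andP.
have /(lipf _ _)/(_ Cx) : C (x + t *: d).
  by apply: convex_set_segment => //; exact: ltW.
rewrite (addrC x) addrK => lip.
have : dotv (gradient f (t *: d + x) - gradient f x) d <= L * t * dotv d d.
  apply: dotv_le_enorm; first by rewrite mulr_gt0.
  rewrite (le_trans lip)// -mulrA ler_wpM2l// ?(ltW L0)//.
  rewrite /enorm dotvZl dotvZr mulrA -expr2 sqrtrM ?sqr_ge0// sqrtr_sqr.
  by rewrite gtr0_norm.
by rewrite dotvDl dotvNl -/m (addrC _ x) /h'; lra.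
Qed.

End Descent.

(** * One iteration *)

(** The one-step estimate in scalars.  With [g] the gradient at [x], [d = w - x]
    and [e = p - w], the variables [gg, gd, dd, ge, de] stand for the inner
    products of these vectors; [proj_p] and [proj_x] are the projection
    inequality tested at [p] and at [x]. *)
Lemma inexact_step_scalar (R : realFieldType)
    (alpha L g1 g2 g3 a gg gd dd ge de fx fw fp : R) :
  let err := alpha ^+ 2 * (g1 + g2) * gg + g2 * (dd + 2 * alpha * gd)
             + g3 * dd in
  0 < alpha -> 0 <= g2 -> 0 <= g3 -> 2 * g2 < 1 -> alpha * L <= 1 - 2 * g3 ->
  0 <= dd -> 2 * g3 <= 1 -> (g1 + g2) * gg <= a ->
  forall (proj_p : - alpha * ge - de <= err) (proj_x : alpha * gd + dd <= err),
  0 <= fp - fx - (ge + gd) -> fw <= fx + gd + L / 2 * dd ->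
  2 * alpha * (fw - fp) <= 2 * de + dd + 2 * alpha ^+ 2 * a / (1 - 2 * g2).
Proof.
move=> err alpha0 g20 g30 g2lt aL dd0 g3lt age proj_p proj_x cvx desc.
have s0 : 0 < 1 - 2 * g2 by lra.
have erra : err <= alpha ^+ 2 * a + (g2 + g3) * dd + 2 * g2 * (alpha * gd).
  have : alpha ^+ 2 * ((g1 + g2) * gg) <= alpha ^+ 2 * a.
    by rewrite ler_wpM2l ?sqr_ge0.
  by rewrite /err; lra.
have main : 2 * alpha * (fw - fp)
    <= 2 * de + dd + (2 * err + (alpha * L - 1) * dd).
  have : alpha * (ge + gd + fw) <= alpha * (fp + (gd + L / 2 * dd)).
    by rewrite ler_wpM2l ?(ltW alpha0)//; lra.
  by lra.
have cross : (1 - 2 * g2) * (alpha * gd) <= alpha ^+ 2 * a - (1 - g2 - g3) * dd.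
  by lra.
have cross2 : g2 * ((1 - 2 * g2) * (alpha * gd))
    <= g2 * (alpha ^+ 2 * a - (1 - g2 - g3) * dd) by rewrite ler_wpM2l.
apply: (le_trans main); rewrite lerD2l ler_pdivlMr//.
(* After inserting [cross2], the coefficient of [a] is exactly
   [2 * alpha^2 * (1 - 2 * g2 + 2 * g2)], and [dd] gets the coefficient
   [- (1 - 2 * g2) * (1 - 2 * g3 - alpha * L) - 2 * g2 * (1 - 2 * g3)]. *)
have slack1 : (1 - 2 * g2) * ((1 - 2 * g3 - alpha * L) * dd) >= 0.
  by rewrite !mulr_ge0 ?subr_ge0// ltW.
have slack2 : g2 * ((1 - 2 * g3) * dd) >= 0 by rewrite !mulr_ge0 ?subr_ge0.
have errs : err * (1 - 2 * g2) <=
   (alpha ^+ 2 * a + (g2 + g3) * dd + 2 * g2 * (alpha * gd)) * (1 - 2 * g2).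
  by rewrite ler_wpM2r// ltW.
by lra.
Qed.

(** Only inner products of the three vectors [gradient f x], [d = w - x] and
    [e = p - w] occur, so expanding all of them bilinearly reduces the estimate
    to [inexact_step_scalar]. *)
Lemma inexact_step (R : realType) (n : nat) (C : set 'rV[R]_n)
    (f : 'rV[R]_n -> R)
    (phi : R -> R -> R -> 'rV[R]_n -> 'rV[R]_n -> 'rV[R]_n -> R)
    (L alpha g1 g2 g3 a : R) (x w p : 'rV[R]_n) :
  convex_set C -> (forall z, differentiable f z) -> 0 < L ->
  gradient_lipschitz_on C L f -> gradient_convex_on C f ->
  error_tolerance phi ->
  0 < alpha -> 0 <= g1 -> 0 <= g2 -> 0 <= g3 -> 2 * g2 < 1 ->
  alpha * L <= 1 - 2 * g3 ->
  gradient f x != 0 -> g1 + g2 <= a / enorm (gradient f x) ^+ 2 ->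
  C x -> C p -> inexact_proj C (phi g1 g2 g3) x (x - alpha *: gradient f x) w ->
  enorm (w - p) ^+ 2 + 2 * alpha * (f w - f p)
  <= enorm (x - p) ^+ 2 + 2 * alpha ^+ 2 * a / (1 - 2 * g2).
Proof.
move=> cC df L0 lipf cvxf tol alpha0 g10 g20 g30 g2lt aL gx0 ga Cx Cp [Cw proj].
have [_] := tol g1 g2 g3 g10 g20 g30 x (x - alpha *: gradient f x) w.
have gg0 : 0 < dotv (gradient f x) (gradient f x).
  by rewrite lt_neqAle eq_sym dotv_eq0 gx0 dotv_ge0.
have := cvxf x p Cx Cp; have := descent cC df L0 lipf Cx Cw.
have := proj x Cx; have := proj p Cp.
move: ga gg0; rewrite !sqr_enorm; set g := gradient f x => ga gg0.
pose d := w - x; pose e := p - w.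
have -> : x - alpha *: g - w = - (alpha *: g) - d.
  by rewrite opprB addrCA addrA.
have -> : w - (x - alpha *: g) = d + alpha *: g by rewrite opprB addrA addrAC.
have -> : x - alpha *: g - x = - (alpha *: g) by rewrite addrAC subrr add0r.
have -> : x - w = - d by rewrite opprB.
have -> : p - x = e + d by rewrite addrA subrK.
have -> : w - p = - e by rewrite opprB.
have -> : x - p = - (e + d) by rewrite addrA subrK opprB.
rewrite -/d -/e; clearbody d e g; rewrite !dotvE (dotvC d g) (dotvC d e).
move=> proj_p proj_x desc cvx tolx.
have dd0 := dotv_ge0 d.
have aL0 : 0 < alpha * L by rewrite mulr_gt0.
move: ga; rewrite ler_pdivlMr// => ga.
have bound : 2 * alpha * (f w - f p)
    <= 2 * dotv e d + dotv d d + 2 * alpha ^+ 2 * a / (1 - 2 * g2).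
  by apply: inexact_step_scalar g20 g30 _ _ _ _ ga _ _ cvx desc => //; lra.
by lra.
Qed.

(** * From one-step decrease to the rate *)

(** Telescoping: each step takes at least [c] times the minimum out of [V],
    which starts at [V 0] and is still nonnegative after [N] steps. *)
Lemma bigmin_le_mean (R : realFieldType) (u V : nat -> R) (c x0 : R) (N : nat) :
  0 < c -> (0 < N)%N -> 0 <= V N ->
  (forall k, V k.+1 + c * u k.+1 <= V k) ->
  \big[Num.min/x0]_(1 <= k < N.+1) u k <= V 0%N / (c * N%:R).
Proof.
move=> c0 N0 VN step; set m := \big[_/_]_(_ <= _ < _) _.
have N0' : 0 < N%:R :> R by rewrite ltr0n.
rewrite ler_pdivlMr ?mulr_gt0//.
have mle k : (k < N)%N -> m <= u k.+1.
  by move=> kN; apply: ge_bigmin_seq; rewrite // mem_index_iota.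
suff avg j : (j <= N)%N -> V j + m * (c * j%:R) <= V 0%N.
  by apply: le_trans (avg N (leqnn N)); rewrite lerDr.
elim: j => [|k ih] kN; first by rewrite !mulr0 addr0.
apply: le_trans (ih (ltnW kN)).
have := step k; have := mle k kN; rewrite -(ler_pM2l c0) -natr1; lra.
Qed.

(* MathComp-Analysis world *)
Theorem theorem13 (R : realType) (n : nat) (C : set 'rV[R]_n)
  (f : 'rV[R]_n -> R)
  (phi : R -> R -> R -> 'rV[R]_n -> 'rV[R]_n -> 'rV[R]_n -> R)
  (L : R) (bm1 : R) (a b : nat -> R) (gbar2 gbar alpha : R)
  (x : nat -> 'rV[R]_n) (xstar : 'rV[R]_n)
  (hC0 : C !=set0) (hCclosed : closed C) (hCconvex : convex_set C)
  (hf : continuously_differentiable f)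
  (hL : 0 < L) (hLip : gradient_lipschitz_on C L f)
  (hphi : error_tolerance phi)
  (hab : forcing_sequences bm1 a b)
  (hgbar2 : gbar2 < 1 / 2) (hgbar : gbar < 1 / 2)
  (halpha0 : 0 < alpha) (halpha : alpha < (1 - 2 * gbar) / L)
  (hx : GInexPM_infinite C f phi a gbar2 gbar alpha x)
  (hconv : gradient_convex_on C f)
  (hxstar : minimizers C f xstar) :
  let fstar := f xstar in
  let rho := alpha / (1 - 2 * gbar2) in
  forall N : nat, (1 <= N)%N ->
    \big[Num.min/(f (x 1%N) - fstar)]_(1 <= k < N.+1) (f (x k) - fstar)
    <= (enorm (x 0%N - xstar) ^+ 2 + 2 * alpha * rho * bm1)
       / (2 * alpha * N%:R).
Proof.
have [_ b0 _ [_ bm10] ha] := hab.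
have [df _] := hf; have [Cp _] := hxstar; have [Cx0 run] := hx.
move=> fstar rho N N1.
have Cx k : C (x k).
  by case: k => // k; have [_ [? [? [? [_ _ _ _ []]]]]] := run k.
have rho0 : 0 < rho by rewrite divr_gt0//; lra.
have cst0 : 0 <= 2 * alpha * rho by rewrite ltW// pmulr_lgt0// mulr_gt0.
pose V k := enorm (x k - xstar) ^+ 2 + 2 * alpha * rho * prev_seq bm1 b k.
apply: (@bigmin_le_mean _ (fun k => f (x k) - fstar) V) => //.
- by rewrite mulr_gt0.
- case: N N1 => // N _; apply: addr_ge0; first exact: sqr_ge0.
  by rewrite mulr_ge0 ?cst0 ?b0.
move=> k; have [gx0 [g1 [g2 [g3 [[g10 g20 g30] ga g2lt g3lt proj]]]]] := run k.
have aL : alpha * L <= 1 - 2 * g3.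
  by move: halpha; rewrite ltr_pdivlMr//; lra.
have := inexact_step hCconvex df hL hLip hconv hphi halpha0 g10 g20 g30 _ aL
  gx0 ga (Cx k) Cp proj.
rewrite -/fstar /V; set err := _ / _; move=> step.
have {step} := step ltac:(lra).
have [ak0 ak] := ha k.
have : err <= 2 * alpha * rho * a k.
  have -> : 2 * alpha * rho * a k = 2 * alpha ^+ 2 * a k / (1 - 2 * gbar2).
    by rewrite /rho; field; lra.
  rewrite /err ler_wpM2l//; first by rewrite !mulr_ge0// ltW.
  by rewrite lef_pV2 ?posrE; lra.
have : 2 * alpha * rho * a k
    <= 2 * alpha * rho * (prev_seq bm1 b k - prev_seq bm1 b k.+1).
  by rewrite ler_wpM2l.
by lra.
Qed.
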